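(* Let $q$ be a power of an odd prime. Then every matrix in $Mat_2(\mathbb{F}_q)$ can be written as a sum of exactly eight orthogonal matrices, i.e. of exactly eight elements of $O(2;q)$. If moreover $q \equiv 3 \pmod 4$, then every matrix in $Mat_2(\mathbb{F}_q)$ can be written as a sum of exactly six orthogonal matrices.
   Context: $Mat_n(\mathbb{F}_q)$ denotes the $n\times n$ matrices over the finite field $\mathbb{F}_q$, and $O(n;q) = \{A \in Mat_n(\mathbb{F}_q) : A^TA = I\}$ is the set (group) of orthogonal matrices. ''A sum of exactly $m$ orthogonal matrices'' means $A = B_1+\dots+B_m$ with each $B_j\in O(n;q)$, repetitions allowed. *)

(* Defs.v *)
From mathcomp Require Import all_boot all_order all_algebra.

Set Implicit Arguments.
Unset Strict Implicit.
Unset Printing Implicit Defensive.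

Import GRing.Theory.
Local Open Scope ring_scope.

Definition orthogonal_mxs (F : finFieldType) (n : nat) : {set 'M[F]_n} :=
  [set A : 'M[F]_n | A^T *m A == 1%:M].

(* The family B need not be injective: repeated summands are allowed. *)
Definition sum_of_orthogonal (F : finFieldType) (n m : nat) (A : 'M[F]_n) : Prop :=
  exists B : 'I_m -> 'M[F]_n,
    (forall j, B j \in orthogonal_mxs F n) /\ A = \sum_(j < m) B j.

(* Main.v *)
Require Import Defs.
From mathcomp Require Import all_boot all_order all_algebra.
From mathcomp Require Import all_fingroup all_solvable all_field ring.

Set Implicit Arguments.
Unset Strict Implicit.
Unset Printing Implicit Defensive.

Import GRing.Theory.
Local Open Scope ring_scope.

(** Over a field of odd characteristic, every 2 x 2 matrix is in a unique way a
sum of a matrix [[x, -y], [y, x]] and a matrix [[z, w], [w, -z]]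
(rotation_reflection_decomposition), and a matrix of either kind is orthogonal
exactly when its parameters lie on the circle a^2 + b^2 = 1.  Hence a matrix with
parameters (x, y) and (z, w) is a sum of m + n orthogonal matrices as soon as
(x, y) is a sum of m circle points and (z, w) a sum of n circle points
(circle_sums_orthogonal).  It remains to write vectors of the plane as sums of
few points of the circle.

If -1 is not a square, which is the case when q = 3 mod 4, the form
N(x, y) = x^2 + y^2 is anisotropic, and every nonzero vector v is a sum of three
circle points.  Indeed, for u and u' on the circle, N(v - u) and
N(u' + (1, 0)) take each value at most twice; as the circle has at least q
points and q is odd, both take more than q / 2 values, so they have a common
value.  Two vectors of equal norm differ by a rotation, so v - u is the image of
u' + (1, 0) by a rotation, hence a sum of two circle points
(circle_sum3_anisotropic).  The zero vector is a sum of two opposite points, and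
every vector is a sum of four points.  The splits 3 + 3, 2 + 4 and 4 + 2 give six
summands, the split 4 + 4 gives eight.

If i^2 = -1, the coordinates X = x + i y and Y = x - i y turn the circle into the
hyperbola of the points (s, 1/s), and one wants four nonzero s_j with sum X whose
inverses have sum Y.  Let N = X Y be nonzero.  With the s_j of the shape
(a, b, 1, -1), (a, a, b, b) or (a, a, a, b) the equations are quadratic, and
they are solvable when N (N - 4), N (N - 16), or (N - 4) (N - 16) respectively is
a square.  The product of these three numbers is a square, so one of them is a
square (inverse_sum4_generic).  In characteristic 3 the third shape degenerates,
and shapes (a, r a, b, r b) with r depending on N replace it
(inverse_sum4_char3).  For N = 0 there is an explicit solution. *)

(** * Counting in finite fields *)

Lemma two_to_one_card (T R : finType) (A : {set T}) (f : T -> R) (sigma : T -> T) :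
    {in A &, forall s t, f s = f t -> t = s \/ t = sigma s} ->
  (#|A| <= 2 * #|f @: A|)%N.
Proof.
move=> fibre.
rewrite -sum1_card (partition_big_imset f) /= mulnC -sum_nat_const.
apply: leq_sum => y /imsetP[s sA ->].
rewrite sum1_card; apply: leq_trans (_ : #|[set s; sigma s]| <= 2)%N; last first.
  by rewrite cards2; case: (_ != _).
apply/subset_leq_card/subsetP=> t; rewrite !inE => /andP[tA /eqP fts].
by case: (fibre s t sA tA (esym fts)) => ->; rewrite eqxx ?orbT.
Qed.

(** The pigeonhole principle: each image has at least half of #|A| >= #|R|
elements, and two disjoint images of exactly half the size of R are excluded by
parity. *)
Lemma two_to_one_images_meet (T R : finType) (A : {set T}) (f g : T -> R)
    (sigma tau : T -> T) :
    odd #|R| -> (#|R| <= #|A|)%N ->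
    {in A &, forall s t, f s = f t -> t = s \/ t = sigma s} ->
    {in A &, forall s t, g s = g t -> t = s \/ t = tau s} ->
  exists s t, [/\ s \in A, t \in A & f s = g t].
Proof.
move=> oddR leRA /two_to_one_card fA /two_to_one_card gA.
have /set0Pn[y /setIP[/imsetP[s sA ->] /imsetP[t tA fst]]] :
    f @: A :&: g @: A != set0; last by exists s, t.
apply/eqP=> fg0.
have := max_card (mem (f @: A :|: g @: A)).
have := cardsUI (f @: A) (g @: A); rewrite fg0 cards0 addn0 => ->.
rewrite leqNgt; apply/negP; rewrite negbK.
have := odd_double_half #|R|; rewrite oddR -mul2n => eR.
move: (leq_trans leRA fA) (leq_trans leRA gA); rewrite -eR add1n !ltn_pmul2l //.
move=> lef leg; apply: leq_trans (leq_add lef leg).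
by rewrite addSn addnS mul2n addnn.
Qed.

Definition is_square (F : finFieldType) (x : F) := exists e, x = e ^+ 2.

(** The unit group is cyclic, and a nonsquare is an odd power of a generator. *)
Lemma mul_nonsquares (F : finFieldType) (x y : F) :
  ~ is_square x -> ~ is_square y -> is_square (x * y).
Proof.
have sq0 : @is_square F 0 by exists 0; rewrite expr0n.
have [-> //|x0] := eqVneq x 0; have [-> //|y0] := eqVneq y 0.
have /cyclicP[g gE] := field_unit_group_cyclic [set: {unit F}].
have pow (z : F) : z != 0 -> exists n, z = val g ^+ n.
  move=> z0; have Uz : z \is a GRing.unit by rewrite unitfE.
  have : FinRing.unit F Uz \in <[g]>%g by rewrite -gE inE.
  case/cycleP=> n eqn; exists n; rewrite -FinRing.val_unitX -eqn //.
have [[m ->] [n ->]] := (pow x x0, pow y y0).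
have odd_pow n1 : ~ is_square (val g ^+ n1) -> odd n1.
  apply: contra_notT => /even_halfK en.
  by exists (val g ^+ n1./2); rewrite -exprM muln2 en.
move=> /odd_pow om /odd_pow on.
exists (val g ^+ (m + n)./2); rewrite -exprD -exprM muln2 even_halfK //.
by rewrite oddD om on.
Qed.

Lemma is_square_or_not (F : finFieldType) (x : F) : is_square x \/ ~ is_square x.
Proof.
case: (boolP [exists e : F, x == e ^+ 2]) => [/existsP[e /eqP ex]|ne].
  by left; exists e.
by right=> -[e ex]; move/existsP: ne; apply; exists e; apply/eqP.
Qed.

(** * Orthogonal matrices and points of the circle *)

Fixpoint circle_sum (F : finFieldType) (m : nat) (x y : F) : Prop :=
  if m is m'.+1
  then exists a b, a ^+ 2 + b ^+ 2 = 1 /\ circle_sum m' (x - a) (y - b)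
  else x = 0 /\ y = 0.

Definition rotation_mx (F : finFieldType) (x y : F) : 'M[F]_2 :=
  \matrix_(i, j) if i == j then x else if i == 0 then - y else y.

Definition reflection_mx (F : finFieldType) (x y : F) : 'M[F]_2 :=
  \matrix_(i, j) if i == j then (if i == 0 then x else - x) else y.

Lemma ord2_cases (i : 'I_2) : i = 0 \/ i = 1.
Proof. by case: i => [[|[|//]] Hi]; [left|right]; apply: val_inj. Qed.

Lemma rotation_mx_orthogonal (F : finFieldType) (a b : F) :
  a ^+ 2 + b ^+ 2 = 1 -> rotation_mx a b \in orthogonal_mxs F 2.
Proof.
move=> ab1; rewrite inE; apply/eqP/matrixP=> i j.
rewrite !mxE big_ord_recl big_ord1 !mxE.
by case: (ord2_cases i) => ->; case: (ord2_cases j) => -> /=; rewrite -?ab1; ring.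
Qed.

Lemma reflection_mx_orthogonal (F : finFieldType) (a b : F) :
  a ^+ 2 + b ^+ 2 = 1 -> reflection_mx a b \in orthogonal_mxs F 2.
Proof.
move=> ab1; rewrite inE; apply/eqP/matrixP=> i j.
rewrite !mxE big_ord_recl big_ord1 !mxE.
by case: (ord2_cases i) => ->; case: (ord2_cases j) => -> /=; rewrite -?ab1; ring.
Qed.

Lemma sum_of_orthogonal0 (F : finFieldType) (n : nat) :
  sum_of_orthogonal 0 (0 : 'M[F]_n).
Proof. by exists (fun=> 0); rewrite big_ord0; split=> // -[]. Qed.

Lemma sum_of_orthogonalS (F : finFieldType) (n m : nat) (A B : 'M[F]_n) :
    B \in orthogonal_mxs F n -> sum_of_orthogonal m (A - B) ->
  sum_of_orthogonal m.+1 A.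
Proof.
move=> oB [C [oC sC]].
exists (fun j => if unlift ord0 j is Some j' then C j' else B); split.
  by move=> j; case: unliftP.
rewrite big_ord_recl unlift_none; under eq_bigr do rewrite liftK.
by rewrite -sC addrC subrK.
Qed.

Lemma circle_sums_orthogonal (F : finFieldType) (m n : nat) (x y z w : F) :
    circle_sum m x y -> circle_sum n z w ->
  sum_of_orthogonal (m + n) (rotation_mx x y + reflection_mx z w).
Proof.
elim: m x y => [|m IHm] x y /=.
  move=> [-> ->]; elim: n z w => [|n IHn] z w /=.
    move=> [-> ->]; set A := (X in sum_of_orthogonal _ X).
    suff -> : A = 0 by apply: sum_of_orthogonal0.
    by apply/matrixP=> i j; rewrite !mxE; do 2!case: (_ == _); rewrite ?oppr0 ?addr0.
  move=> [a [b [/reflection_mx_orthogonal ab1 /IHn]]] h; apply: sum_of_orthogonalS ab1 _.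
  congr (sum_of_orthogonal _ _): h; apply/matrixP=> i j; rewrite !mxE.
  by do 2!case: (_ == _); ring.
move=> [a [b [/rotation_mx_orthogonal ab1 cm]]] cn.
rewrite addSn; apply: sum_of_orthogonalS ab1 _.
congr (sum_of_orthogonal _ _): (IHm _ _ cm cn); apply/matrixP=> i j; rewrite !mxE.
by do 2!case: (_ == _); ring.
Qed.

Lemma rotation_reflection_decomposition (F : finFieldType) (A : 'M[F]_2) : (2 : F) != 0 ->
  exists x y z w, A = rotation_mx x y + reflection_mx z w.
Proof.
move=> nz2.
exists ((A 0 0 + A 1 1) / 2), ((A 1 0 - A 0 1) / 2).
exists ((A 0 0 - A 1 1) / 2), ((A 1 0 + A 0 1) / 2).
apply/matrixP=> i j; rewrite !mxE.
by case: (ord2_cases i) => ->; case: (ord2_cases j) => -> /=; field.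
Qed.

(** * Sums of circle points when -1 is not a square *)

Definition anisotropic (F : finFieldType) := forall e : F, e ^+ 2 != -1.

Lemma anisotropic_norm_eq0 (F : finFieldType) (a b : F) :
  anisotropic F -> a ^+ 2 + b ^+ 2 = 0 -> a = 0 /\ b = 0.
Proof.
move=> anis /eqP; have [-> | b0] := eqVneq b 0.
  by rewrite expr0n addr0 sqrf_eq0 => /eqP.
rewrite addr_eq0 => /eqP ab; case/negP: (anis (a / b)).
by rewrite expr_div_n ab mulNr divff // expf_neq0.
Qed.

Definition circle (F : finFieldType) : {set F * F} :=
  [set u | u.1 ^+ 2 + u.2 ^+ 2 == 1].

(** The lines through (-1, 0) of slope t parametrize the circle; the denominators
1 + t^2 never vanish because -1 is not a square. *)
Lemma card_circle_ge (F : finFieldType) : (2 : F) != 0 -> anisotropic F ->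
  (#|F| <= #|circle F|)%N.
Proof.
move=> nz2 anis.
have nz (t : F) : 1 + t ^+ 2 != 0.
  by rewrite addrC addr_eq0.
pose h (t : F) := ((1 - t ^+ 2) / (1 + t ^+ 2), (2 * t) / (1 + t ^+ 2)).
have h_inj : injective h.
  have hK : cancel h (fun u => u.2 / (1 + u.1)).
    move=> t /=; have tn := nz t.
    have -> : 1 + (1 - t ^+ 2) / (1 + t ^+ 2) = 2 / (1 + t ^+ 2) by field.
    by field; apply/andP.
  exact: can_inj hK.
rewrite -cardsT -(card_imset _ h_inj); apply/subset_leq_card/subsetP=> u /imsetP[t _ ->].
by rewrite inE /=; apply/eqP; field.
Qed.

(** The scalar product of v = (x, y) with a circle point determines the cross
product up to sign, because the sum of their squares is the norm of v; the two
products together determine the point.  The second alternative is the mirror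
image of (a, b) in the line spanned by v. *)
Lemma dot_fibre (F : finFieldType) (x y a b c d : F) :
    x ^+ 2 + y ^+ 2 != 0 -> a ^+ 2 + b ^+ 2 = 1 -> c ^+ 2 + d ^+ 2 = 1 ->
    x * a + y * b = x * c + y * d ->
  (c, d) = (a, b) \/
  (c, d) = (((x ^+ 2 - y ^+ 2) * a + 2 * x * y * b) / (x ^+ 2 + y ^+ 2),
            (2 * x * y * a - (x ^+ 2 - y ^+ 2) * b) / (x ^+ 2 + y ^+ 2)).
Proof.
move=> N0 ab cd dot.
have : (x * b - y * a - (x * d - y * c)) * (x * b - y * a + (x * d - y * c)) = 0.
  have e1 : (x * b - y * a) ^+ 2 + (x * a + y * b) ^+ 2 = x ^+ 2 + y ^+ 2.
    by rewrite -[RHS]mulr1 -ab; ring.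
  have e2 : (x * d - y * c) ^+ 2 + (x * c + y * d) ^+ 2 = x ^+ 2 + y ^+ 2.
    by rewrite -[RHS]mulr1 -cd; ring.
  rewrite -subr_sqr; apply/eqP; rewrite subr_eq0; apply/eqP.
  by apply: (addIr ((x * a + y * b) ^+ 2)); rewrite e1 dot e2.
have cE : c = (x * (x * c + y * d) - y * (x * d - y * c)) / (x ^+ 2 + y ^+ 2) by field.
have dE : d = (y * (x * c + y * d) + x * (x * d - y * c)) / (x ^+ 2 + y ^+ 2) by field.
move/eqP; rewrite mulf_eq0 subr_eq0 addr_eq0 => /orP[] /eqP cross.
  by left; congr (_, _); [rewrite cE|rewrite dE]; rewrite -dot -cross; field.
by right; congr (_, _); [rewrite cE|rewrite dE];
  rewrite -dot -[x * d - y * c]opprK -cross; field.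
Qed.

Lemma circle_sum2_0 (F : finFieldType) : circle_sum 2 (0 : F) 0.
Proof.
exists 1, 0; split; first by rewrite expr1n expr0n addr0.
exists (-1), 0; split; first by rewrite sqrrN expr1n expr0n addr0.
by split; ring.
Qed.

(** Pick circle points u and u' such that v - u and u' + (1, 0) have the same
norm.  If it is nonzero, the rotation taking the latter to the former writes v - u
as a sum of two circle points; if it is zero then v = u. *)
Lemma circle_sum3_anisotropic (F : finFieldType) (x y : F) :
    (2 : F) != 0 -> odd #|F| -> anisotropic F -> x ^+ 2 + y ^+ 2 != 0 ->
  circle_sum 3 x y.
Proof.
move=> nz2 oddF anis N0.
have [[a b] [[c d] [/[!inE]/= /eqP ab /eqP cd norms]]] :
    exists u v : F * F, [/\ u \in circle F, v \in circle F &
      x ^+ 2 + y ^+ 2 + 1 - 2 * (x * u.1 + y * u.2) = 2 + 2 * v.1].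
  pose N := x ^+ 2 + y ^+ 2.
  apply: (@two_to_one_images_meet _ F _ _ _
    (fun u => (((x ^+ 2 - y ^+ 2) * u.1 + 2 * x * y * u.2) / N,
               (2 * x * y * u.1 - (x ^+ 2 - y ^+ 2) * u.2) / N))
    (fun v => (v.1, - v.2)) oddF (card_circle_ge nz2 anis)).
    move=> [a b] [c d]; rewrite !inE /= => /eqP ab /eqP cd dot.
    apply: dot_fibre => //; apply: (mulfI nz2).
    by apply: oppr_inj; apply: (addrI (x ^+ 2 + y ^+ 2 + 1)).
  move=> [a b] [c d]; rewrite !inE /= => /eqP ab /eqP cd /addrI/(mulfI nz2) ac.
  move: cd; rewrite -ab ac => /addrI/eqP; rewrite eqf_sqr.
  by case/orP=> /eqP ->; [left|right].
have eqN : (x - a) ^+ 2 + (y - b) ^+ 2 = (1 + c) ^+ 2 + d ^+ 2.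
  transitivity (x ^+ 2 + y ^+ 2 + (a ^+ 2 + b ^+ 2) - 2 * (x * a + y * b)); first ring.
  rewrite ab norms; transitivity (1 + 2 * c + (c ^+ 2 + d ^+ 2)); last by ring.
  by rewrite cd; ring.
exists a, b; split=> //.
have [M0|M0] := eqVneq ((1 + c) ^+ 2 + d ^+ 2) 0.
  have [-> ->] := anisotropic_norm_eq0 anis (etrans eqN M0).
  exact: circle_sum2_0.
set M := _ + _ in M0.
(* (e, f) is the quotient of v - u by u' + (1, 0) as complex numbers. *)
pose e := ((x - a) * (1 + c) + (y - b) * d) / M.
pose f := ((y - b) * (1 + c) - (x - a) * d) / M.
have ef : e ^+ 2 + f ^+ 2 = 1.
  transitivity (((x - a) ^+ 2 + (y - b) ^+ 2) * ((1 + c) ^+ 2 + d ^+ 2) / M ^+ 2).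
    by rewrite /e /f; field.
  by rewrite eqN -/M -expr2 divff // expf_neq0.
exists e, f; split=> //.
exists (e * c - f * d), (e * d + f * c); split.
  by rewrite -[RHS]mulr1 -{1}ef -cd; ring.
by rewrite /e /f /M; split; field.
Qed.

(** At least one of the vectors v - (1, 0) and v + (1, 0) is nonzero, hence a sum
of three circle points. *)
Lemma circle_sum4_anisotropic (F : finFieldType) (x y : F) :
  (2 : F) != 0 -> odd #|F| -> anisotropic F -> circle_sum 4 x y.
Proof.
move=> nz2 oddF anis.
have step a : a ^+ 2 = 1 -> x != a \/ y != 0 -> circle_sum 4 x y.
  move=> a1 xya; exists a, 0; split; first by rewrite a1 expr0n addr0.
  apply: circle_sum3_anisotropic => //; apply/eqP => /(anisotropic_norm_eq0 anis)[].
  by move=> /subr0_eq xa; rewrite subr0 => y0; case: xya; rewrite ?xa ?y0 eqxx.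
have [x1|x1] := eqVneq x 1; last by apply: (step 1); [rewrite expr1n|left].
apply: (step (-1)); first by rewrite sqrrN expr1n.
by left; rewrite x1 -subr_eq0 opprK -mulr2n.
Qed.

(** A square root e of -1 would satisfy e^q = - e, whereas e^q = e. *)
Lemma anisotropic_3mod4 (F : finFieldType) : (2 : F) != 0 -> #|F| = 3 %[mod 4] -> anisotropic F.
Proof.
move=> nz2 F34 e; apply/negP=> /eqP e2.
have e0 : e != 0.
  by apply: contra_eq_neq e2 => ->; rewrite expr0n /= eq_sym oppr_eq0 oner_neq0.
have := expf_card e; rewrite (divn_eq #|F| 4) F34 -[(3 %% 4)%N]/3%N.
rewrite (_ : (_ + 3)%N = (2 * (2 * (#|F| %/ 4) + 1) + 1)%N); last by ring.
rewrite exprD exprM e2 exprD exprM sqrrN expr1n expr1n !expr1 mul1r mulN1r => /eqP.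
by rewrite eq_sym -addr_eq0 -mulr2n -mulr_natl mulf_eq0 (negPf nz2) (negPf e0).
Qed.

(** * Sums of circle points when -1 is a square *)

(** For i^2 = -1, the point of the circle with a + i b = s has a - i b = 1/s, and
every nonzero s occurs. *)
Lemma circle_sum4_of_inverses (F : finFieldType) (i s1 s2 s3 s4 x y : F) :
    (2 : F) != 0 -> i ^+ 2 = -1 -> s1 != 0 -> s2 != 0 -> s3 != 0 -> s4 != 0 ->
    s1 + s2 + s3 + s4 = x + i * y ->
    s1^-1 + s2^-1 + s3^-1 + s4^-1 = x - i * y ->
  circle_sum 4 x y.
Proof.
move=> nz2 i2 n1 n2 n3 n4 sX sY.
have on (s : F) : s != 0 ->
    ((s + s^-1) / 2) ^+ 2 + (- i * (s - s^-1) / 2) ^+ 2 = 1.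
  move=> s0; rewrite !exprMn sqrrN i2; field.
  by apply/andP.
exists ((s1 + s1^-1) / 2), (- i * (s1 - s1^-1) / 2); split; first exact: on.
exists ((s2 + s2^-1) / 2), (- i * (s2 - s2^-1) / 2); split; first exact: on.
exists ((s3 + s3^-1) / 2), (- i * (s3 - s3^-1) / 2); split; first exact: on.
exists ((s4 + s4^-1) / 2), (- i * (s4 - s4^-1) / 2); split; first exact: on.
have xE : x = ((s1 + s2 + s3 + s4) + (s1^-1 + s2^-1 + s3^-1 + s4^-1)) / 2.
  by rewrite sX sY; field.
have yE : y = - i * ((s1 + s2 + s3 + s4) - (s1^-1 + s2^-1 + s3^-1 + s4^-1)) / 2.
  by rewrite sX sY; transitivity (- i ^+ 2 * y); [rewrite i2; ring|field].
by split; [rewrite xE|rewrite yE]; field; do ?[apply/andP; split].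
Qed.

(** Eliminating b leaves a quadratic equation for a, whose discriminant is the
left-hand side of the hypothesis: Heron's form in X Y, al al' and be be', hence
symmetric in the three.  It is what allows the vector (X, Y), of norm X Y, to be a
sum of vectors of norms al al' and be be'. *)
Lemma weighted_inverse_pair (F : finFieldType) (X Y al al' be be' d : F) :
    (2 : F) != 0 -> X != 0 -> Y != 0 ->
    al != 0 -> al' != 0 -> be != 0 -> be' != 0 ->
    (X * Y - al * al' - be * be') ^+ 2 - 4 * (al * al') * (be * be') = d ^+ 2 ->
  exists a b, [/\ a != 0, b != 0, al * a + be * b = X & al' / a + be' / b = Y].
Proof.
move=> nz2 X0 Y0 l0 l'0 b0 b'0 dE.
have nz4 : (4 : F) != 0 by rewrite (_ : 4 = 2 * 2) ?mulf_neq0 //; ring.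
pose p := X * Y + al * al' - be * be' + d.
pose r := X * Y - al * al' + be * be' - d.
(* p times its conjugate is 4 (X Y) (al al'), which is nonzero. *)
have p0 : p != 0.
  have : p * (X * Y + al * al' - be * be' - d) != 0.
    rewrite (_ : _ * _ = 4 * (X * Y) * (al * al')) ?mulf_neq0 //.
    transitivity ((X * Y + al * al' - be * be') ^+ 2 - d ^+ 2); first by rewrite /p; ring.
    by rewrite -dE; ring.
  by apply: contraNneq => ->; rewrite mul0r.
have r0 : r != 0.
  have : r * (X * Y - al * al' + be * be' + d) != 0.
    rewrite (_ : _ * _ = 4 * (X * Y) * (be * be')) ?mulf_neq0 //.
    transitivity ((X * Y - al * al' + be * be') ^+ 2 - d ^+ 2); first by rewrite /r; ring.
    by rewrite -dE; ring.
  by apply: contraNneq => ->; rewrite mul0r.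
exists (p / (2 * al * Y)), (r / (2 * be * Y)); split; rewrite ?mulf_neq0 ?invr_neq0 ?mulf_neq0 //.
  by rewrite /p /r; field; do ?[apply/andP; split].
apply/eqP; rewrite -subr_eq0.
rewrite (_ : _ - _ = Y / (p * r) * (2 * (al * al') * r + 2 * (be * be') * p - p * r)); last first.
  by field; do ?[apply/andP; split].
rewrite (_ : _ - _ = 0) ?mulr0 //.
transitivity (d ^+ 2 - ((X * Y - al * al' - be * be') ^+ 2 - 4 * (al * al') * (be * be'))).
  by rewrite /p /r; ring.
by rewrite dE subrr.
Qed.

Definition inverse_sum4 (F : finFieldType) (X Y : F) :=
  exists s1 s2 s3 s4, [/\ s1 != 0, s2 != 0, s3 != 0 & s4 != 0] /\
    [/\ s1 + s2 + s3 + s4 = X & s1^-1 + s2^-1 + s3^-1 + s4^-1 = Y].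

Lemma inverse_sum4_cancelling (F : finFieldType) (X Y : F) :
    (2 : F) != 0 -> X != 0 -> Y != 0 -> is_square (X * Y * (X * Y - 4)) ->
  inverse_sum4 X Y.
Proof.
move=> nz2 X0 Y0 [d dE].
have n1 := oner_neq0 F.
have [|a [b [a0 b0 <- <-]]] := @weighted_inverse_pair F X Y 1 1 1 1 d nz2 X0 Y0 n1 n1 n1 n1.
  by rewrite -dE; ring.
exists a, b, 1, (-1); split.
  by rewrite oppr_eq0 oner_neq0.
by rewrite invrN invr1 !mul1r !addrK.
Qed.

Lemma inverse_sum4_three_equal (F : finFieldType) (X Y : F) :
    (2 : F) != 0 -> (3 : F) != 0 -> X != 0 -> Y != 0 ->
    is_square ((X * Y - 4) * (X * Y - 16)) ->
  inverse_sum4 X Y.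
Proof.
move=> nz2 nz3 X0 Y0 [d dE].
have n1 := oner_neq0 F.
have [|a [b [a0 b0 <- <-]]] := @weighted_inverse_pair F X Y 3 3 1 1 d nz2 X0 Y0 nz3 nz3 n1 n1.
  by rewrite -dE; ring.
by exists a, a, a, b; split=> //; split; field; do ?[apply/andP; split].
Qed.

(** In the shape (a, r a, b, r b), both pairs are vectors of norm (1 + r)^2 / r; the
condition is that the discriminant N (N - 4 (1 + r)^2 / r), multiplied by r^2, is a
square. *)
Lemma inverse_sum4_ratio (F : finFieldType) (r X Y : F) :
    (2 : F) != 0 -> r != 0 -> 1 + r != 0 -> X != 0 -> Y != 0 ->
    is_square (X * Y * r * (X * Y * r - 4 * (1 + r) ^+ 2)) ->
  inverse_sum4 X Y.
Proof.
move=> nz2 r0 r1 X0 Y0 [d dE].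
have r1' : (1 + r) / r != 0 by rewrite mulf_neq0 ?invr_neq0.
have [|a [b [a0 b0 <- <-]]] := @weighted_inverse_pair F X Y
    (1 + r) ((1 + r) / r) (1 + r) ((1 + r) / r) (d / r) nz2 X0 Y0 r1 r1' r1 r1'.
  by rewrite expr_div_n -dE; field.
exists a, (r * a), b, (r * b); split; first by rewrite !mulf_neq0.
by split; field; do ?[apply/andP; split].
Qed.

(** In the shape (x, x, b, i b), the choice of b makes b + i b = - x and
1/b + 1/(i b) = - 2/x. *)
Lemma inverse_sum4_isotropic (F : finFieldType) (i x : F) :
    (2 : F) != 0 -> i ^+ 2 = -1 -> x != 0 ->
  inverse_sum4 x 0.
Proof.
move=> nz2 i2 x0.
have i0 : i != 0.
  by apply: contra_eq_neq i2 => ->; rewrite expr0n /= eq_sym oppr_eq0 oner_neq0.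
have ii : (1 - i) * (1 + i) = 2.
  by transitivity (1 - i ^+ 2); [ring|rewrite i2; ring].
have [im ip] : 1 - i != 0 /\ 1 + i != 0.
  by apply/norP; rewrite -mulf_eq0 ii.
exists x, x, (- (1 - i) * x / 2), (- i * (1 - i) * x / 2); split.
  by split=> //; rewrite !mulf_neq0 ?oppr_eq0 ?invr_neq0.
split.
  transitivity (x * (4 - (1 - i) * (1 + i)) / 2); first by field.
  by rewrite ii; field.
transitivity ((2 * i * (1 - i) - 2 * (1 + i)) / (i * (1 - i) * x)).
  by field; rewrite !oppr_eq0 x0 im i0 nz2.
rewrite (_ : _ - _ = - 2 * (1 + i ^+ 2)); last by ring.
by rewrite i2 subrr mulr0 mul0r.
Qed.

(** The three shapes (a, b, 1, -1), (a, a, b, b) and (a, a, a, b) suffice. *)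
Lemma inverse_sum4_generic (F : finFieldType) (X Y : F) :
    (2 : F) != 0 -> (3 : F) != 0 -> X != 0 -> Y != 0 ->
  inverse_sum4 X Y.
Proof.
move=> nz2 nz3 X0 Y0.
have N0 : X * Y != 0 by rewrite mulf_neq0.
have [|sq4] := is_square_or_not (X * Y * (X * Y - 4)).
  exact: inverse_sum4_cancelling nz2 X0 Y0.
have [|sq16] := is_square_or_not (X * Y * (X * Y - 16)).
  move=> sq; have n1 := oner_neq0 F.
  apply: (@inverse_sum4_ratio F 1) => //.
  by congr is_square: sq; ring.
apply: inverse_sum4_three_equal => //.
have [d dE] := mul_nonsquares sq4 sq16.
by exists (d / (X * Y)); rewrite expr_div_n -dE; field; apply/andP.
Qed.

(** With 3 = 0 and 4 = 1, the shape (a, r a, b, r b) works for r = N as soon as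
N - 1 is a square, and for r = i when N = -1.  Otherwise, and if N (N - 1) is not a
square either, N = n^2, and the conditions for r = n and r = -n have product N - 1
up to squares: a nonsquare, so one of the two conditions holds. *)
Lemma inverse_sum4_char3 (F : finFieldType) (i X Y : F) :
    (3 : F) = 0 -> i ^+ 2 = -1 -> X != 0 -> Y != 0 ->
  inverse_sum4 X Y.
Proof.
move=> z3 i2 X0 Y0.
have e2 : (2 : F) = -1 by apply/eqP; rewrite -subr_eq0 -z3; apply/eqP; ring.
have e4 : (4 : F) = 1 by apply/eqP; rewrite -subr_eq0 -z3; apply/eqP; ring.
have nz2 : (2 : F) != 0 by rewrite e2 oppr_eq0 oner_neq0.
have ip : 1 + i != 0.
  apply: contra_neq nz2 => ip.
  transitivity ((1 + i) * (1 - i)); last by rewrite ip mul0r.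
  by transitivity (1 - i ^+ 2); [rewrite i2; ring|ring].
have i0 : i != 0.
  by apply: contra_eq_neq i2 => ->; rewrite expr0n /= eq_sym oppr_eq0 oner_neq0.
set N := X * Y.
have N0 : N != 0 by rewrite mulf_neq0.
have ratio r := @inverse_sum4_ratio F r X Y nz2.
have [Nm1|Nm1] := eqVneq (1 + N) 0.
  apply: (ratio i) => //; exists 0.
  rewrite -/N e4 (_ : N = -1); last by apply/eqP; rewrite -addr_eq0 addrC; apply/eqP.
  transitivity (- i * (- 3 * i - (1 + i ^+ 2))); first by ring.
  by rewrite z3 i2; ring.
have [|nsq4] := is_square_or_not (N * (N - 4)).
  exact: inverse_sum4_cancelling nz2 X0 Y0.
have [[e eE]|nsq1] := is_square_or_not (N - 1).
  apply: (ratio N) => //; exists (N * e).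
  rewrite -/N exprMn -eE e4.
  by transitivity (N ^+ 2 * (N - 1 - 3 * N)); [ring|rewrite z3; ring].
have N1 : N - 1 != 0.
  by apply/eqP => N1; apply: nsq1; exists 0; rewrite N1 expr0n.
have [n nE] : is_square N.
  have [d dE] := mul_nonsquares nsq4 nsq1.
  exists (d / (N - 1)); rewrite expr_div_n -dE e4; field => //.
have nn : (1 + n) * (1 - n) != 0.
  by rewrite (_ : _ * _ = - (N - 1)) ?oppr_eq0 // nE; ring.
have [n1 n1'] : 1 + n != 0 /\ 1 + - n != 0 by apply/norP; rewrite -mulf_eq0.
have n0 : n != 0 by apply: contraNneq N0 => n0; rewrite nE n0 expr0n.
have [|nsqp] := is_square_or_not (N * n * (N * n - 4 * (1 + n) ^+ 2)).
  exact: ratio n0 n1 X0 Y0.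
apply: (ratio (- n)); rewrite ?oppr_eq0 //.
have [//|nsqm] := is_square_or_not (N * - n * (N * - n - 4 * (1 + - n) ^+ 2)).
case: nsq1; have [d dE] := mul_nonsquares nsqp nsqm.
exists (d / (n ^+ 3 * (n ^+ 2 + 1))); rewrite expr_div_n -dE e4 nE.
have n21 : n ^+ 2 + 1 != 0 by rewrite addrC -nE.
(* In these two equations, the cubics factor after adding a multiple of 3. *)
have -> : n ^+ 2 * n * (n ^+ 2 * n - 1 * (1 + n) ^+ 2) = n ^+ 3 * (n - 1) * (n ^+ 2 + 1).
  by transitivity (n ^+ 3 * ((n - 1) * (n ^+ 2 + 1) - 3 * n)); [ring|rewrite z3; ring].
have -> : n ^+ 2 * - n * (n ^+ 2 * - n - 1 * (1 + - n) ^+ 2) = n ^+ 3 * (n + 1) * (n ^+ 2 + 1).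
  by transitivity (n ^+ 3 * ((n + 1) * (n ^+ 2 + 1) - 3 * n)); [ring|rewrite z3; ring].
by field; rewrite n21.
Qed.

Lemma circle_sum4_split (F : finFieldType) (i x y : F) :
  (2 : F) != 0 -> i ^+ 2 = -1 -> circle_sum 4 x y.
Proof.
move=> nz2 i2.
suff [s1 [s2 [s3 [s4 [[n1 n2 n3 n4] [sX sY]]]]]] : inverse_sum4 (x + i * y) (x - i * y).
  exact: circle_sum4_of_inverses sX sY.
move: (x + _) (x - _) => X Y.
have [->|X0] := eqVneq X 0; have [->|Y0] := eqVneq Y 0.
- have n1 := oner_neq0 F.
  exists 1, (-1), 1, (-1); rewrite oppr_eq0; split=> //.
  by rewrite invrN invr1 subrr add0r subrr.
- have [s1 [s2 [s3 [s4 [[n1 n2 n3 n4] [sX sY]]]]]] := inverse_sum4_isotropic nz2 i2 Y0.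
  by exists s1^-1, s2^-1, s3^-1, s4^-1; rewrite !invr_eq0 !invrK.
- exact: inverse_sum4_isotropic i2 X0.
have [z3|nz3] := eqVneq (3 : F) 0; first exact: inverse_sum4_char3 i2 X0 Y0.
exact: inverse_sum4_generic.
Qed.

(** * Sums of orthogonal matrices *)

Theorem theorem1p1 (p k q : nat) (F : finFieldType)
    (p_prime : prime p) (p_odd : odd p) (k_gt0 : (0 < k)%N)
    (q_def : q = (p ^ k)%N) (F_card : #|F| = q) :
  (forall A : 'M[F]_2, sum_of_orthogonal 8 A) /\
  (q = 3 %[mod 4] -> forall A : 'M[F]_2, sum_of_orthogonal 6 A).
Proof.
have oddF : odd #|F| by rewrite F_card q_def oddX p_odd orbT.
have nz2 : (2 : F) != 0.
  have chF : p \in [pchar F] by exact: card_finPcharP (etrans F_card q_def) p_prime.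
  rewrite -(dvdn_pcharf chF); apply: contraL (odd_prime_gt2 p_odd p_prime).
  by rewrite -leqNgt; apply: dvdn_leq.
have sum4 x y : circle_sum 4 (x : F) y.
  have [/existsP[i /eqP i2]|/existsPn anis] := boolP [exists i : F, i ^+ 2 == -1].
    exact: circle_sum4_split i2.
  exact: circle_sum4_anisotropic.
split=> [A|q34 A]; have [x [y [z [w ->]]]] := rotation_reflection_decomposition A nz2.
  exact: (@circle_sums_orthogonal F 4 4).
have anis : anisotropic F by apply: anisotropic_3mod4 => //; rewrite F_card.
have zero_or_sum3 a b : (a = 0 /\ b = 0) \/ circle_sum 3 (a : F) b.
  have [/(anisotropic_norm_eq0 anis)|ab] := eqVneq (a ^+ 2 + b ^+ 2) 0; first by left.
  by right; apply: circle_sum3_anisotropic.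
have [[-> ->]|sxy] := zero_or_sum3 x y.
  exact: (@circle_sums_orthogonal F 2 4 _ _ _ _ (circle_sum2_0 F)).
have [[-> ->]|szw] := zero_or_sum3 z w.
  exact: (@circle_sums_orthogonal F 4 2 _ _ _ _ _ (circle_sum2_0 F)).
exact: (@circle_sums_orthogonal F 3 3).
Qed.
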